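(* Let $n=r+s$ with $0<r<n$, and let $M^{(3)}_{r,s}$ be the super vector space of complex $n$th order cubic $(r,s)$-supermatrices. For homogeneous $A,B,C\in M^{(3)}_{r,s}$ of degrees $a,b,c\in\mathbb Z_2$ define the graded triple commutator $$[A,B,C]=\mathrm{Str}^{(j)}A\;[B,C]+(-1)^{a(b+c)}\,\mathrm{Str}^{(j)}B\;[C,A]+(-1)^{c(a+b)}\,\mathrm{Str}^{(j)}C\;[A,B],$$ where $[A,B]=A\ast_j B-(-1)^{ab}B\ast_j A$ is the graded commutator of cubic supermatrices (both brackets being extended multilinearly). Then this graded triple commutator satisfies the graded Filippov-Jacobi identity, and the super vector space $M^{(3)}_{r,s}$ equipped with it is a $3$-Lie superalgebra.
   Context: A complex cubic matrix of order $n$ is a family $A=(A_{ijk})_{1\le i,j,k\le n}$ of complex numbers. For $1\le l\le n$ its $l$th section of orientation $(j)$ is the $n\times n$ matrix $A^{(j)}_l=(A_{ilk})_{i,k}$ (second subscript fixed equal to $l$). The product relative to direction $(j)$, $A\ast_j B$, is the cubic matrix with sections $(A\ast_j B)^{(j)}_l=A^{(j)}_l\cdot B^{(j)}_l$ (ordinary matrix product) for $l=1,\ldots,n$. Cubic $(r,s)$-supermatrices, $r+s=n$: the index values $1,\ldots,r$ of the first subscript $i$ and of the third subscript $k$ are given parity $\bar 0$, and the values $r+1,\ldots,n$ are given parity $\bar 1$; the entry $A_{ijk}$ has parity equal to the sum of the parities of $i$ and $k$. Thus each section $A^{(j)}_l$ is a square $(r,s)$-supermatrix with even diagonal blocks of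 sizes $r\times r$ and $s\times s$ and odd off-diagonal blocks. $A$ is of even degree $\bar 0$ if all its odd-parity entries vanish, and of odd degree $\bar 1$ if all its even-parity entries vanish. $M^{(3)}_{r,s}$ denotes the resulting super vector space of complex cubic $(r,s)$-supermatrices. The supertrace relative to direction $(j)$ is $\mathrm{Str}^{(j)}A=\sum_{l=1}^n\mathrm{Str}\,A^{(j)}_l$, where $\mathrm{Str}$ of a square $(r,s)$-supermatrix is the trace of its upper-left $r\times r$ block minus the trace of its lower-right $s\times s$ block. A super vector space $\mathfrak g=\mathfrak g_0\oplus\mathfrak g_1$ (with $\bar x$ the degree of a homogeneous element $x$) is a $3$-Lie superalgebra if it has a trilinear bracket with $[\mathfrak g_\alpha,\mathfrak g_\beta,\mathfrak g_\gamma]\subseteq\mathfrak g_{\alpha+\beta+\gamma}$ which is graded skew-symmetric, $$[x,y,z]=-(-1)^{\bar x\bar y}[y,x,z],\quad [x,y,z]=-(-1)^{\bar y\bar z}[x,z,y],\quad [x,y,z]=-(-1)^{\bar x\bar y+\bar y\bar z+\bar x\bar z}[z,y,x],$$ and satisfies the graded Filippov-Jacobi identity $$[x,y,[z,v,w]]=[[x,y,z],v,w]+(-1)^{(\bar x+\bar y)\bar z}[z,[x,y,v],w]+(-1)^{(\bar x+\bar y)(\bar z+\bar v)}[z,v,[x,y,w]]$$ for all homogeneous elements. *)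

(* Defs.v *)
From mathcomp Require Import all_boot all_order all_algebra.

Set Implicit Arguments.
Unset Strict Implicit.
Unset Printing Implicit Defensive.

Import GRing.Theory.
Local Open Scope ring_scope.

(* Degrees live in 'Z_2; the exponent of a sign is computed in 'Z_2 and then
   read as a natural number (0 or 1), which is harmless since (-1)^2 = 1. *)
Definition zsign (K : fieldType) (a : 'Z_2) : K := (-1) ^+ (a : nat).

(* The submodules [g 0] and [g 1] are in direct sum and span [V]. *)
Definition super_vector_space (K : fieldType) (V : lmodType K)
    (g : 'Z_2 -> {pred V}) : Prop :=
  (forall a : 'Z_2, submod_closed (g a)) /\
  (forall x : V, exists! p : V * V,
     [/\ p.1 \in g 0, p.2 \in g 1 & x = p.1 + p.2]).

Definition trilinear (K : fieldType) (V : lmodType K) (br : V -> V -> V -> V)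
    : Prop :=
  [/\ forall y z, linear (fun x => br x y z),
      forall x z, linear (fun y => br x y z)
    & forall x y, linear (fun z => br x y z)].

Definition graded_Filippov_Jacobi (K : fieldType) (V : lmodType K)
    (g : 'Z_2 -> {pred V}) (br : V -> V -> V -> V) : Prop :=
  forall (a b c d e : 'Z_2) (x y z v w : V),
    x \in g a -> y \in g b -> z \in g c -> v \in g d -> w \in g e ->
    br x y (br z v w) =
      br (br x y z) v w
      + zsign K ((a + b) * c) *: br z (br x y v) w
      + zsign K ((a + b) * (c + d)) *: br z v (br x y w).

Record is_3Lie_superalgebra (K : fieldType) (V : lmodType K)
    (g : 'Z_2 -> {pred V}) (br : V -> V -> V -> V) : Prop := {
  tls_super : super_vector_space g;
  tls_trilinear : trilinear br;
  tls_degree : forall (a b c : 'Z_2) (x y z : V),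
    x \in g a -> y \in g b -> z \in g c -> br x y z \in g (a + b + c);
  tls_skew12 : forall (a b c : 'Z_2) (x y z : V),
    x \in g a -> y \in g b -> z \in g c ->
    br x y z = - (zsign K (a * b) *: br y x z);
  tls_skew23 : forall (a b c : 'Z_2) (x y z : V),
    x \in g a -> y \in g b -> z \in g c ->
    br x y z = - (zsign K (b * c) *: br x z y);
  tls_skew13 : forall (a b c : 'Z_2) (x y z : V),
    x \in g a -> y \in g b -> z \in g c ->
    br x y z = - (zsign K (a * b + b * c + a * c) *: br z y x);
  tls_Filippov_Jacobi : graded_Filippov_Jacobi g br
}.

(* The entry A_{ijk} is [A (i, j, k)]; subscripts are numbered from 0. *)
Definition cubic_index (n : nat) : finType := ('I_n * 'I_n * 'I_n)%type.
Notation cubic K n := {ffun cubic_index n -> K^o}.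

Definition jsection (K : fieldType) (n : nat) (A : cubic K n) (l : 'I_n)
    : 'M[K]_n :=
  \matrix_(i, k) A (i, l, k).

Definition of_jsections (K : fieldType) (n : nat) (M : 'I_n -> 'M[K]_n)
    : cubic K n :=
  [ffun t : cubic_index n => let: (i, l, k) := t in M l i k].

Definition jmul (K : fieldType) (n : nat) (A B : cubic K n) : cubic K n :=
  of_jsections (fun l => jsection A l *m jsection B l).

Section Super.
Variables (K : fieldType) (r s : nat).
Local Notation M3 := (cubic K (r + s)).

Definition parity (i : 'I_(r + s)) : 'Z_2 := if (i < r)%N then 0 else 1.

Definition entry_parity (t : cubic_index (r + s)) : 'Z_2 :=
  let: (i, _, k) := t in parity i + parity k.

(* [A] has degree [a]; the zero matrix has both degrees. *)
Definition cubic_hom (a : 'Z_2) : {pred M3} :=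
  [pred A : M3 | [forall t, (entry_parity t != a) ==> (A t == 0)]].

Definition cubic_comp (a : 'Z_2) (A : M3) : M3 :=
  [ffun t => if entry_parity t == a then A t else 0].

Definition supertrace (M : 'M[K]_(r + s)) : K :=
  \tr (ulsubmx M) - \tr (drsubmx M).

Definition jStr (A : M3) : K := \sum_(l < r + s) supertrace (jsection A l).

(* The graded commutator for arguments of degrees [a] and [b], followed by its
   bilinear extension; likewise below for the triple commutator. *)
Definition hom_comm (a b : 'Z_2) (A B : M3) : M3 :=
  jmul A B - zsign K (a * b) *: jmul B A.

Definition graded_comm (A B : M3) : M3 :=
  \sum_(a : 'Z_2) \sum_(b : 'Z_2) hom_comm a b (cubic_comp a A) (cubic_comp b B).

Definition hom_tcomm (a b c : 'Z_2) (A B C : M3) : M3 :=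
  jStr A *: graded_comm B C
  + zsign K (a * (b + c)) *: (jStr B *: graded_comm C A)
  + zsign K (c * (a + b)) *: (jStr C *: graded_comm A B).

Definition graded_tcomm (A B C : M3) : M3 :=
  \sum_(a : 'Z_2) \sum_(b : 'Z_2) \sum_(c : 'Z_2)
     hom_tcomm a b c (cubic_comp a A) (cubic_comp b B) (cubic_comp c C).

(* On homogeneous arguments the extensions agree with the defining formulas. *)
Lemma cubic_comp_hom a b A : A \in cubic_hom a ->
  cubic_comp b A = if b == a then A else 0.
Proof.
move=> /forallP hA; apply/ffunP => t; rewrite ffunE eq_sym.
have := hA t; case: (eqVneq b a) => [->|ba].
  by rewrite eq_sym; case: eqVneq => //= _ /eqP ->.
rewrite !ffunE; case: (eqVneq b (entry_parity t)) => [<-|//].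
by rewrite ba => /eqP.
Qed.

Lemma jmul0 (A : M3) : jmul A 0 = 0.
Proof.
apply/ffunP => -[[i l] k]; rewrite !ffunE mxE big1 // => m _.
by rewrite !mxE ffunE mulr0.
Qed.

Lemma jmul0l (A : M3) : jmul 0 A = 0.
Proof.
apply/ffunP => -[[i l] k]; rewrite !ffunE mxE big1 // => m _.
by rewrite !mxE ffunE mul0r.
Qed.

Lemma jStr0 : jStr 0 = 0.
Proof.
rewrite /jStr big1 // => l _; rewrite /supertrace /mxtrace.
by rewrite !big1 ?subr0 // => i _; rewrite !mxE ffunE.
Qed.

Lemma graded_commE a b A B : A \in cubic_hom a -> B \in cubic_hom b ->
  graded_comm A B = jmul A B - zsign K (a * b) *: jmul B A.
Proof.
move=> hA hB; rewrite /graded_comm (bigD1 a) //= [X in _ + X]big1 ?addr0.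
  rewrite (bigD1 b) //= [X in _ + X]big1 ?addr0.
    by rewrite !(cubic_comp_hom _ hA, cubic_comp_hom _ hB) !eqxx.
  move=> d /negbTE db; rewrite (cubic_comp_hom _ hB) db.
  by rewrite /hom_comm jmul0 jmul0l scaler0 subr0.
move=> d /negbTE da; rewrite big1 // => e _; rewrite (cubic_comp_hom _ hA) da.
by rewrite /hom_comm jmul0 jmul0l scaler0 subr0.
Qed.

Lemma graded_comm0 A : graded_comm A 0 = 0.
Proof.
have h0 c : 0 \in cubic_hom c by apply/forallP=> t; rewrite ffunE eqxx implybT.
rewrite /graded_comm big1 // => a _; rewrite big1 // => b _.
rewrite (cubic_comp_hom _ (h0 b)) eqxx.
by rewrite /hom_comm jmul0 jmul0l scaler0 subr0.
Qed.

Lemma graded_comm0l A : graded_comm 0 A = 0.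
Proof.
have h0 c : 0 \in cubic_hom c by apply/forallP=> t; rewrite ffunE eqxx implybT.
rewrite /graded_comm big1 // => a _; rewrite big1 // => b _.
rewrite (cubic_comp_hom _ (h0 a)) eqxx.
by rewrite /hom_comm jmul0 jmul0l scaler0 subr0.
Qed.

Lemma graded_tcommE a b c A B C :
  A \in cubic_hom a -> B \in cubic_hom b -> C \in cubic_hom c ->
  graded_tcomm A B C =
    jStr A *: graded_comm B C
    + zsign K (a * (b + c)) *: (jStr B *: graded_comm C A)
    + zsign K (c * (a + b)) *: (jStr C *: graded_comm A B).
Proof.
move=> hA hB hC; have z := (jStr0, graded_comm0, graded_comm0l).
rewrite /graded_tcomm (bigD1 a) //= [X in _ + X]big1 ?addr0; last first.
  move=> d /negbTE da; rewrite big1 // => e _; rewrite big1 // => f _.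
  rewrite (cubic_comp_hom _ hA) da.
  by rewrite /hom_tcomm !z ?(scale0r, scaler0) !addr0.
rewrite (bigD1 b) //= [X in _ + X]big1 ?addr0; last first.
  move=> d /negbTE db; rewrite big1 // => f _.
  rewrite (cubic_comp_hom _ hB) db.
  by rewrite /hom_tcomm !z ?(scale0r, scaler0) !addr0.
rewrite (bigD1 c) //= [X in _ + X]big1 ?addr0; last first.
  move=> d /negbTE dc; rewrite (cubic_comp_hom _ hC) dc.
  by rewrite /hom_tcomm !z ?(scale0r, scaler0) !addr0.
by rewrite (cubic_comp_hom _ hA) (cubic_comp_hom _ hB) (cubic_comp_hom _ hC) !eqxx.
Qed.

End Super.

(* Main.v *)
Require Import Defs.
From mathcomp Require Import all_boot all_order all_algebra.
From mathcomp Require Import reals complex.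
From HB Require Import structures.
Import GRing.Theory.
Local Open Scope ring_scope.

(** Multiplying sections pairwise makes the cubic matrices an associative
graded algebra, so the graded commutator [A, B] makes them a Lie superalgebra.
The linear form tau = Str^(j) vanishes on odd elements and on graded
commutators.  From any Lie superalgebra with such a form one gets a 3-Lie
superalgebra by setting
  [x, y, z] = tau x [y, z] - tau y [x, z] + tau z [x, y],
which is [trace_bracket].  The signs in the definition of the graded triple
commutator reduce to these three by the graded skew-symmetry of [C, A] and
because (-1)^(a d) tau x = tau x whenever x has degree a: either a = 0 or
tau x = 0 ([trace_sign]).  Hence
[graded_tcomm] is [trace_bracket] ([graded_tcomm_trace]).

The Filippov-Jacobi identity for [trace_bracket] comes from splitting
the map u |-> [x, y, u] as D u + tau u J, where D = tau x ad_y - tau y ad_x and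
J = [x, y].  The graded Jacobi identity makes D a derivation of the Lie
bracket of degree equal to that of J ([inner_part_derivation]), and tau
vanishes on every triple bracket.  So the terms with D on the two sides agree,
while the terms with J cancel in pairs by graded skew-symmetry
([trace_bracket_Filippov_Jacobi]). *)

Set Implicit Arguments.
Unset Strict Implicit.
Unset Printing Implicit Defensive.

(** * Parities and signs *)

Lemma Z2P (a : 'Z_2) : a = 0 \/ a = 1.
Proof. by case: a => [[|[|//]] h]; [left|right]; apply: val_inj. Qed.

Lemma Z2_addxx (a : 'Z_2) : a + a = 0.
Proof. by case: (Z2P a) => ->; apply: val_inj. Qed.

Section Sign.
Variable K : fieldType.
Implicit Types a b : 'Z_2.

Lemma zsign0 : zsign K 0 = 1. Proof. exact: expr0. Qed.

Lemma zsignD a b : zsign K (a + b) = zsign K a * zsign K b.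
Proof. by rewrite /zsign -exprD /= modn2 signr_odd. Qed.

Lemma zsignK a : zsign K a * zsign K a = 1.
Proof. by rewrite -expr2 sqrr_sign. Qed.

End Sign.

(** * The triple bracket of a Lie superalgebra with a supertrace *)

Section TripleBracket.
Variables (K : fieldType) (V : lmodType K) (g : 'Z_2 -> {pred V}).
Variables (br : V -> V -> V) (tau : {scalar V}).
Hypothesis g_submod : forall a, submod_closed (g a).
Hypothesis br_linl : forall y, linear (br^~ y).
Hypothesis br_linr : forall x, linear (br x).
Hypothesis br_deg : forall a b x y,
  x \in g a -> y \in g b -> br x y \in g (a + b).
Hypothesis br_skew : forall a b x y,
  x \in g a -> y \in g b -> br x y = - (zsign K (a * b) *: br y x).
Hypothesis br_Jacobi : forall a b c x y z,
  x \in g a -> y \in g b -> z \in g c ->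
  br x (br y z) = br (br x y) z + zsign K (a * b) *: br y (br x z).
Hypothesis tau_odd : forall x, x \in g 1 -> tau x = 0.
Hypothesis tau_br : forall x y, tau (br x y) = 0.

Implicit Types (a b c d : 'Z_2) (k : K) (x y z u v w : V).

Definition trace_bracket x y z :=
  tau x *: br y z - tau y *: br x z + tau z *: br x y.

Let brDl u x y : br (x + y) u = br x u + br y u.
Proof. by have := br_linl u 1 x y; rewrite !scale1r. Qed.
Let brDr u x y : br u (x + y) = br u x + br u y.
Proof. by have := br_linr u 1 x y; rewrite !scale1r. Qed.
Let br0l u : br 0 u = 0.
Proof. by apply: (addrI (br 0 u)); rewrite -brDl !addr0. Qed.
Let br0r u : br u 0 = 0.
Proof. by apply: (addrI (br u 0)); rewrite -brDr !addr0. Qed.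
Let brZl u k x : br (k *: x) u = k *: br x u.
Proof. by have := br_linl u k x 0; rewrite !(br0l, addr0). Qed.
Let brZr u k x : br u (k *: x) = k *: br u x.
Proof. by have := br_linr u k x 0; rewrite !(br0r, addr0). Qed.
Let brNl u x : br (- x) u = - br x u.
Proof. by rewrite -scaleN1r brZl scaleN1r. Qed.
Let brNr u x : br u (- x) = - br u x.
Proof. by rewrite -scaleN1r brZr scaleN1r. Qed.

(** The reason all signs attached to a supertrace disappear: a nonzero
supertrace forces even degree. *)
Lemma trace_sign a d x : x \in g a -> zsign K (a * d) * tau x = tau x.
Proof.
case: (Z2P a) => -> hx; first by rewrite mul0r zsign0 mul1r.
by rewrite tau_odd // mulr0.
Qed.

(** Scaling by [tau x] may be said to shift degrees by that of [x]: for odd [x]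
the result is zero, which has every degree. *)
Lemma trace_scale_deg a d x u :
  x \in g a -> u \in g d -> tau x *: u \in g (a + d).
Proof.
case: (Z2P a) => -> hx hu; last first.
  by rewrite tau_odd // scale0r; case: (g_submod (1 + d)).
rewrite add0r; have [g0 gl] := g_submod d.
by rewrite -[X in X \in _]addr0; apply: gl.
Qed.

Lemma g_add a x y : x \in g a -> y \in g a -> x + y \in g a.
Proof. by case: (g_submod a) => _ gl hx hy; rewrite -[x]scale1r; apply: gl. Qed.

Lemma g_opp a x : x \in g a -> - x \in g a.
Proof.
by case: (g_submod a) => g0 gl hx; rewrite -[- x]addr0 -scaleN1r; apply: gl.
Qed.

Lemma trace_bracket_trilinear : trilinear trace_bracket.
Proof.
split=> [y z|x z|x y] k u v; rewrite /trace_bracket !linearP /=;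
  rewrite !(brDl, brDr, brZl, brZr, scalerDl, scalerDr, scalerN) !scalerA;
  rewrite !(mulrC k) !opprD;
  by rewrite [LHS](AC (2*2*2) (1*3*5*(2*4*6))).
Qed.

Lemma trace_bracket_deg a b c x y z : x \in g a -> y \in g b -> z \in g c ->
  trace_bracket x y z \in g (a + b + c).
Proof.
move=> hx hy hz; apply: g_add; first apply: g_add.
- by rewrite -addrA; apply: trace_scale_deg => //; apply: br_deg.
- rewrite (addrC a) -addrA; apply: g_opp.
  by apply: trace_scale_deg => //; apply: br_deg.
- by rewrite addrC; apply: trace_scale_deg => //; apply: br_deg.
Qed.

Lemma trace_bracket_skew12 a b x y z : x \in g a -> y \in g b ->
  trace_bracket x y z = - (zsign K (a * b) *: trace_bracket y x z).
Proof.
move=> hx hy; rewrite /trace_bracket scalerDr scalerBr !scalerA.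
rewrite (trace_sign _ hx) (mulrC a) (trace_sign _ hy) (br_skew hx hy).
by rewrite (mulrC a) scalerN scalerA (mulrC (tau z)) opprD opprB.
Qed.

Lemma trace_bracket_skew23 b c x y z : y \in g b -> z \in g c ->
  trace_bracket x y z = - (zsign K (b * c) *: trace_bracket x z y).
Proof.
move=> hy hz; rewrite /trace_bracket scalerDr scalerBr !scalerA.
rewrite (trace_sign _ hy) (mulrC b) (trace_sign _ hz) (br_skew hy hz).
rewrite (mulrC b) scalerN scalerA (mulrC (tau x)) !opprD opprK.
by rewrite addrAC.
Qed.

(** The exchange of the outer arguments is a product of three exchanges of
neighbours. *)
Lemma trace_bracket_skew13 a b c x y z :
    x \in g a -> y \in g b -> z \in g c ->
  trace_bracket x y z =
    - (zsign K (a * b + b * c + a * c) *: trace_bracket z y x).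
Proof.
move=> hx hy hz; rewrite (trace_bracket_skew12 _ hx hy).
rewrite (trace_bracket_skew23 _ hx hz) (trace_bracket_skew12 _ hy hz).
rewrite !(scalerN, opprK) !scalerA -!zsignD; congr (- (zsign K _ *: _)).
by rewrite addrAC.
Qed.

(** The part of the map [u |-> trace_bracket x y u] that is an inner derivation
of the Lie superalgebra; what is left is [tau u] times [br x y]. *)
Definition inner_part x y u := tau x *: br y u - tau y *: br x u.

Lemma trace_bracketE x y u :
  trace_bracket x y u = inner_part x y u + tau u *: br x y.
Proof. by []. Qed.

(** Where [tau x] is nonzero, [br y] has the degree [a + b] of [br x y], because
then [a = 0]; likewise for [br x] and [tau y].  So the two adjoint maps obey one
and the same sign rule. *)
Lemma inner_part_derivation a b c d x y z v :
    x \in g a -> y \in g b -> z \in g c -> v \in g d ->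
  inner_part x y (br z v) =
    br (inner_part x y z) v + zsign K ((a + b) * c) *: br z (inner_part x y v).
Proof.
move=> hx hy hz hv; rewrite /inner_part (br_Jacobi hy hz hv) (br_Jacobi hx hz hv).
rewrite !(brDl, brDr, brNl, brNr, brZl, brZr) !scalerDr scalerN !scalerA opprD.
rewrite addrACA.
have -> : zsign K ((a + b) * c) * tau x = tau x * zsign K (b * c).
  by rewrite mulrDl zsignD mulrAC (trace_sign _ hx).
have -> : zsign K ((a + b) * c) * tau y = tau y * zsign K (a * c).
  by rewrite mulrDl zsignD -mulrA (trace_sign _ hy) mulrC.
by [].
Qed.

Lemma trace_trace_bracket x y z : tau (trace_bracket x y z) = 0.
Proof.
by rewrite linearD linearB !linearZ /= !tau_br !mulr0 subr0 addr0.
Qed.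

Lemma trace_bracket_Filippov_Jacobi : graded_Filippov_Jacobi g trace_bracket.
Proof.
move=> a b c d e x y z v w hx hy hz hv hw.
(* D and J are made opaque so that rewriting cannot look inside them. *)
have [D DE] : exists D, forall u, D u = inner_part x y u by exists (inner_part x y).
have [J JE] : exists J, J = br x y by exists (br x y).
have hJ : J \in g (a + b) by rewrite JE; apply: br_deg.
have xyE u : trace_bracket x y u = D u + tau u *: J.
  by rewrite DE JE trace_bracketE.
pose S1 := zsign K ((a + b) * c); pose S2 := zsign K ((a + b) * d).
have S12 : zsign K ((a + b) * (c + d)) = S1 * S2 by rewrite mulrDr zsignD.
have S1z : S1 * tau z = tau z by rewrite /S1 (mulrC (a + b)) trace_sign.
have S2v : S2 * tau v = tau v by rewrite /S2 (mulrC (a + b)) trace_sign.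
have zJ : S1 *: br z J = - br J z.
  by rewrite (br_skew hz hJ) scalerN scalerA (mulrC c) zsignK scale1r.
have vJ : S2 *: br v J = - br J v.
  by rewrite (br_skew hv hJ) scalerN scalerA (mulrC d) zsignK scale1r.
(* Each term of the right side is a part in D plus a part in J; the parts in J
   form a cyclic sum of differences. *)
have E1 : trace_bracket (trace_bracket x y z) v w =
    (tau w *: br (D z) v - tau v *: br (D z) w)
    + ((tau w * tau z) *: br J v - (tau v * tau z) *: br J w).
  rewrite {1}/trace_bracket trace_trace_bracket scale0r sub0r xyE.
  rewrite !(brDl, brZl) !scalerDr !scalerA opprD addrC addrACA //.
have E2 : S1 *: trace_bracket z (trace_bracket x y v) w =
    (tau z *: br (D v) w + tau w *: (S1 *: br z (D v)))
    + ((tau v * tau z) *: br J w - (tau w * tau v) *: br J z).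
  rewrite {1}/trace_bracket trace_trace_bracket scale0r subr0 xyE.
  rewrite !(brDl, brDr, brZl, brZr) !scalerDr addrACA !scalerA S1z.
  rewrite -mulrA !(mulrC S1) -(scalerA _ S1 (br z J)) zJ scalerN.
  by rewrite (mulrC (tau z)) -(scalerA (tau w) S1).
have E3 : (S1 * S2) *: trace_bracket z v (trace_bracket x y w) =
    (tau z *: (S2 *: br v (D w)) - tau v *: (S1 *: br z (D w)))
    + ((tau w * tau v) *: br J z - (tau w * tau z) *: br J v).
  rewrite {1}/trace_bracket trace_trace_bracket scale0r addr0 xyE.
  rewrite !(brDr, brZr) !scalerDr opprD addrACA scalerDr !scalerN !scalerA.
  have -> : S1 * S2 * tau z = tau z * S2 by rewrite mulrAC S1z mulrC.
  have -> : S1 * S2 * tau v = tau v * S1 by rewrite -mulrA S2v mulrC.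
  rewrite !(mulrAC _ _ (tau w)) -(scalerA _ S2 (br v J)) vJ.
  rewrite -(scalerA _ S1 (br z J)) zJ !scalerN opprK.
  rewrite (mulrC (tau z) (tau w)) (mulrC (tau v) (tau w)).
  by rewrite [LHS](AC (2*2) (1*4*(3*2))).
rewrite S12 E1 E2 E3 [LHS]xyE trace_trace_bracket scale0r addr0.
have -> : D (trace_bracket z v w) =
    tau z *: D (br v w) - tau v *: D (br z w) + tau w *: D (br z v).
  rewrite !DE /inner_part /trace_bracket !(brDr, brNr, brZr) !scalerDr !scalerN.
  rewrite !scalerA !(mulrC (tau x)) !(mulrC (tau y)) !opprD !opprK.
  by rewrite [LHS](AC (3*3) (1*4*(2*5)*(3*6))).
rewrite !DE (inner_part_derivation hx hy hz hv) (inner_part_derivation hx hy hz hw).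
rewrite (inner_part_derivation hx hy hv hw) -!DE -/S1 -/S2 !scalerDr opprD.
have cancel3 (p q t : V) : (p - q) + (q - t) + (t - p) = 0.
  by rewrite !subrKA subrr.
rewrite [RHS](AC (2*2*2) (1*3*5*(2*4*6))) /= cancel3 addr0.
by rewrite [LHS](AC (2*2*2) ((5*3)*(1*6)*(2*4))).
Qed.


(** The bracket is given up to pointwise equality, so that it may be one defined
by another formula. *)
Lemma trace_bracket_3Lie t :
    (forall x y z, t x y z = trace_bracket x y z) -> super_vector_space g ->
  is_3Lie_superalgebra g t.
Proof.
move=> tE g_super; have [linx liny linz] := trace_bracket_trilinear.
split=> //.
- split=> [y z|x z|x y] k u v; rewrite !tE; [exact: linx|exact: liny|].
  exact: linz.
- by move=> a b c x y z; rewrite tE; apply: trace_bracket_deg.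
- by move=> a b c x y z hx hy _; rewrite !tE; apply: trace_bracket_skew12.
- by move=> a b c x y z _ hy hz; rewrite !tE; apply: trace_bracket_skew23.
- by move=> a b c x y z hx hy hz; rewrite !tE; apply: trace_bracket_skew13.
- move=> a b c d e x y z v w hx hy hz hv hw; rewrite !tE.
  exact: trace_bracket_Filippov_Jacobi hx hy hz hv hw.
Qed.

End TripleBracket.
Lemma linear_sumE (K : fieldType) (U W : lmodType K) (f : U -> W) (I : finType)
    (F : I -> U) :
  linear f -> f (\sum_i F i) = \sum_i f (F i).
Proof.
move=> f_lin; apply: (big_morph f) => [x y|].
  by have := f_lin 1 x y; rewrite !scale1r.
by have := f_lin (-1) 0 0; rewrite !scaleN1r !addNr.
Qed.

(** * Cubic supermatrices *)

Section Cubic.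
Variables (K : fieldType) (r s : nat).
Local Notation M3 := (cubic K (r + s)).
Local Notation hom := (@cubic_hom K r s).
Local Notation comp := (@cubic_comp K r s).
Local Notation gcomm := (@graded_comm K r s).
Implicit Types (a b c : 'Z_2) (A B C : M3).

Lemma cubic_homP a A :
  reflect (forall t, entry_parity t != a -> A t = 0) (A \in hom a).
Proof.
apply: (iffP forallP) => h t; first by move=> ta; apply/eqP; exact: implyP ta.
by apply/implyP => ta; rewrite h.
Qed.

Lemma cubic_hom_submod a : submod_closed (hom a).
Proof.
split=> [|k A B /cubic_homP hA /cubic_homP hB].
  by apply/cubic_homP => t _; rewrite ffunE.
by apply/cubic_homP => t ta; rewrite !ffunE hA // hB // scaler0 addr0.
Qed.

Lemma cubic_comp_in a A : comp a A \in hom a.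
Proof. by apply/cubic_homP => t; rewrite ffunE => /negbTE ->. Qed.

Lemma cubic_comp_linear a : linear (comp a).
Proof.
by move=> k A B; apply/ffunP => t; rewrite !ffunE; case: ifP;
  rewrite // scaler0 addr0.
Qed.

Lemma cubic_comp_sum A : A = \sum_a comp a A.
Proof.
apply/ffunP => t; rewrite sum_ffunE (bigD1 (entry_parity t)) //= ffunE eqxx.
rewrite big1 ?addr0 // => a /negbTE ta; rewrite ffunE eq_sym ta //.
Qed.

Lemma cubic_super : super_vector_space hom.
Proof.
split=> [|A]; first exact: cubic_hom_submod.
exists (comp 0 A, comp 1 A); split=> /=.
  split; try exact: cubic_comp_in.
  by rewrite {1}(cubic_comp_sum A) !big_ord_recl big_ord0 addr0;
    congr (comp _ A + comp _ A); apply: val_inj.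
case=> B C [/= hB hC ->]; have compD d : comp d (B + C) = comp d B + comp d C.
  by have := cubic_comp_linear d 1 B C; rewrite !scale1r.
by rewrite !compD !(cubic_comp_hom _ hB) !(cubic_comp_hom _ hC) addr0 add0r.
Qed.

Lemma jmulE A B i l k :
  jmul A B (i, l, k) = \sum_m A (i, l, m) * B (m, l, k).
Proof. by rewrite ffunE mxE; apply: eq_bigr => m _; rewrite !mxE. Qed.

Lemma jmul_linl B : linear (@jmul K (r + s) ^~ B).
Proof.
move=> k A A'; apply/ffunP => -[[i l] q]; rewrite !ffunE !mxE.
rewrite scaler_sumr -big_split; apply: eq_bigr => m _.
by rewrite !mxE !ffunE mulrDl scalerAl.
Qed.

Lemma jmul_linr A : linear (@jmul K (r + s) A).
Proof.
move=> k B B'; apply/ffunP => -[[i l] q]; rewrite !ffunE !mxE.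
rewrite scaler_sumr -big_split; apply: eq_bigr => m _.
by rewrite !mxE !ffunE mulrDr scalerAr.
Qed.

Lemma jmulBl A A' B : jmul (A - A') B = jmul A B - jmul A' B.
Proof. by rewrite addrC -scaleN1r jmul_linl scaleN1r addrC. Qed.

Lemma jmulBr A B B' : jmul A (B - B') = jmul A B - jmul A B'.
Proof. by rewrite addrC -scaleN1r jmul_linr scaleN1r addrC. Qed.

Lemma jmulZl k A B : jmul (k *: A) B = k *: jmul A B.
Proof. by rewrite -[k *: A]addr0 jmul_linl jmul0l addr0. Qed.

Lemma jmulZr k A B : jmul A (k *: B) = k *: jmul A B.
Proof. by rewrite -[k *: B]addr0 jmul_linr jmul0 addr0. Qed.

Lemma jsection_jmul A B l : jsection (jmul A B) l = jsection A l *m jsection B l.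
Proof. by apply/matrixP => i k; rewrite mxE ffunE. Qed.

Lemma jmulA A B C : jmul A (jmul B C) = jmul (jmul A B) C.
Proof.
by apply/ffunP => -[[i l] k]; rewrite !ffunE !jsection_jmul mulmxA.
Qed.

Lemma jmul_hom a b A B : A \in hom a -> B \in hom b -> jmul A B \in hom (a + b).
Proof.
move=> /cubic_homP hA /cubic_homP hB; apply/cubic_homP => -[[i l] k] /= ik.
rewrite jmulE big1 // => m _.
case: (eqVneq (parity i + parity m) a) => [im|im]; last by rewrite hA ?mul0r.
rewrite hB ?mulr0 //=; apply: contraNneq ik => <-; rewrite -im.
by rewrite -addrA (addrA (parity m)) Z2_addxx add0r.
Qed.

Lemma supertraceE (M : 'M[K]_(r + s)) :
  supertrace M = \sum_i zsign K (parity i) * M i i.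
Proof.
rewrite /supertrace /mxtrace big_split_ord /= -sumrN; congr (_ + _).
  by apply: eq_bigr => i _; rewrite !mxE /parity /= ltn_ord zsign0 mul1r.
apply: eq_bigr => i _; rewrite !mxE /parity /= ltnNge leq_addr /=.
by rewrite /zsign expr1 mulN1r.
Qed.

Lemma jStrE A : jStr A = \sum_l \sum_i zsign K (parity i) * A (i, l, i).
Proof.
apply: eq_bigr => l _; rewrite supertraceE.
by apply: eq_bigr => i _; rewrite mxE.
Qed.

Fact jStr_linear : scalar (@jStr K r s).
Proof.
move=> k A B; rewrite !jStrE mulr_sumr -big_split; apply: eq_bigr => l _ /=.
rewrite mulr_sumr -big_split; apply: eq_bigr => i _ /=.
by rewrite !ffunE mulrDr mulrCA.
Qed.

HB.instance Definition _ :=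
  GRing.isLinear.Build K M3 K _ (@jStr K r s) jStr_linear.

Lemma jStr_odd A : A \in hom 1 -> jStr A = 0.
Proof.
move=> /cubic_homP hA; rewrite jStrE big1 // => l _; rewrite big1 // => i _.
by rewrite hA ?mulr0 //= Z2_addxx.
Qed.

(** Cyclicity of the trace, term by term: a nonzero term
A (i, l, m) * B (m, l, i) requires p i + p m = a = b for the parities p, and then
p i = p m + a * b in 'Z_2. *)
Lemma jStr_jmulC a b A B : A \in hom a -> B \in hom b ->
  jStr (jmul A B) = zsign K (a * b) * jStr (jmul B A).
Proof.
move=> /cubic_homP hA /cubic_homP hB.
rewrite !jStrE mulr_sumr; apply: eq_bigr => l _.
under eq_bigr => i _ do rewrite jmulE mulr_sumr.
rewrite exchange_big mulr_sumr; apply: eq_bigr => m _ /=.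
rewrite jmulE !mulr_sumr; apply: eq_bigr => i _.
case: (eqVneq (parity i + parity m) a) => [im|im]; last first.
  by rewrite hA // !(mul0r, mulr0).
case: (eqVneq (parity m + parity i) b) => [mi|mi]; last first.
  by rewrite hB // !(mul0r, mulr0).
rewrite mulrA -zsignD (mulrC (B _)) -im -mi; congr (zsign K _ * _).
by case: (Z2P (parity i)) => ->; case: (Z2P (parity m)) => ->; apply: val_inj.
Qed.

Lemma graded_comm_linl B : linear (gcomm^~ B).
Proof.
move=> k A A'; rewrite /graded_comm scaler_sumr -big_split /=.
apply: eq_bigr => a _; rewrite scaler_sumr -big_split; apply: eq_bigr => b _ /=.
rewrite /hom_comm cubic_comp_linear jmul_linl jmul_linr.
by rewrite scalerBr scalerDr !scalerA (mulrC k) opprD addrACA.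
Qed.

Lemma graded_comm_linr A : linear (gcomm A).
Proof.
move=> k B B'; rewrite /graded_comm scaler_sumr -big_split /=.
apply: eq_bigr => a _; rewrite scaler_sumr -big_split; apply: eq_bigr => b _ /=.
rewrite /hom_comm cubic_comp_linear jmul_linl jmul_linr.
by rewrite scalerBr scalerDr !scalerA (mulrC k) opprD addrACA.
Qed.

Lemma graded_comm_deg a b A B : A \in hom a -> B \in hom b ->
  gcomm A B \in hom (a + b).
Proof.
move=> hA hB; rewrite (graded_commE hA hB) addrC -scaleNr.
apply: (cubic_hom_submod _).2; last exact: jmul_hom.
by rewrite addrC; apply: jmul_hom.
Qed.

Lemma graded_comm_skew a b A B : A \in hom a -> B \in hom b ->
  gcomm A B = - (zsign K (a * b) *: gcomm B A).
Proof.
move=> hA hB; rewrite (graded_commE hA hB) (graded_commE hB hA) (mulrC b).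
by rewrite scalerBr scalerA zsignK scale1r opprB.
Qed.

(** The mixed terms B A C on the right cancel by associativity. *)
Lemma graded_comm_Leibniz a b c A B C :
    A \in hom a -> B \in hom b -> C \in hom c ->
  gcomm A (jmul B C) =
    jmul (gcomm A B) C + zsign K (a * b) *: jmul B (gcomm A C).
Proof.
move=> hA hB hC; rewrite (graded_commE hA (jmul_hom hB hC)).
rewrite (graded_commE hA hB) (graded_commE hA hC) mulrDr zsignD.
rewrite jmulBl jmulZl jmulBr jmulZr scalerBr scalerA !jmulA.
by rewrite addrA subrK.
Qed.

(** Expanding only the inner commutator on the left and the outer ones on the
right, the Leibniz rule leaves the same four products on both sides. *)
Lemma graded_comm_Jacobi a b c A B C :
    A \in hom a -> B \in hom b -> C \in hom c ->
  gcomm A (gcomm B C) =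
    gcomm (gcomm A B) C + zsign K (a * b) *: gcomm B (gcomm A C).
Proof.
move=> hA hB hC.
rewrite (graded_commE (graded_comm_deg hA hB) hC).
rewrite (graded_commE hB (graded_comm_deg hA hC)) (graded_commE hB hC).
rewrite addrC -scaleNr graded_comm_linr.
rewrite (graded_comm_Leibniz hA hB hC) (graded_comm_Leibniz hA hC hB).
rewrite mulrDl mulrDr !zsignD (mulrC b a).
rewrite scalerBr !scalerDr !scalerA mulrA zsignK mul1r !scaleNr mulNr scaleNr.
by rewrite (mulrC (zsign K (b * c))) [LHS](AC (2*2) (3*2*(4*1))).
Qed.

Lemma jStr_graded_comm A B : jStr (gcomm A B) = 0.
Proof.
rewrite /graded_comm linear_sum big1 // => a _; rewrite linear_sum big1 // => b _.
rewrite linearB linearZ /=.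
by rewrite (jStr_jmulC (cubic_comp_in a A) (cubic_comp_in b B)) subrr.
Qed.



(** Beyond the removal of signs by [trace_sign], the middle term is turned from
[C, A] into [A, C]. *)
Lemma hom_tcommE a b c A B C : A \in hom a -> B \in hom b -> C \in hom c ->
  hom_tcomm a b c A B C = trace_bracket gcomm (@jStr K r s) A B C.
Proof.
move=> hA hB hC; rewrite /hom_tcomm /trace_bracket !scalerA.
have sgn := @trace_sign _ _ _ (@jStr K r s) jStr_odd.
rewrite (sgn _ _ _ hC) (mulrDr a) zsignD (mulrC a b) mulrAC -mulrA.
rewrite (graded_comm_skew hC hA) (mulrC c a) scalerN scalerA.
by rewrite mulrA sgn // -mulrA zsignK mulr1.
Qed.

(** Both sides are trilinear, and they agree on homogeneous components. *)
Lemma graded_tcomm_trace A B C :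
  graded_tcomm A B C = trace_bracket gcomm (@jStr K r s) A B C.
Proof.
have [linA linB linC] :=
  trace_bracket_trilinear (@jStr K r s) graded_comm_linl graded_comm_linr.
rewrite {2}(cubic_comp_sum A) (linear_sumE _ (linA _ _)).
apply: eq_bigr => a _.
rewrite {2}(cubic_comp_sum B) (linear_sumE _ (linB _ _)).
apply: eq_bigr => b _.
rewrite {2}(cubic_comp_sum C) (linear_sumE _ (linC _ _)).
by apply: eq_bigr => c _; apply: hom_tcommE; apply: cubic_comp_in.
Qed.

Lemma cubic_3Lie : is_3Lie_superalgebra hom (@graded_tcomm K r s).
Proof.
apply: (trace_bracket_3Lie cubic_hom_submod graded_comm_linl graded_comm_linr
  graded_comm_deg graded_comm_skew graded_comm_Jacobi jStr_odd jStr_graded_comm).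
- exact: graded_tcomm_trace.
- exact: cubic_super.
Qed.

End Cubic.

Theorem mainTheorem3 (R : realType) (r s : nat) (hr : (0 < r < r + s)%N) :
  graded_Filippov_Jacobi (@cubic_hom R[i] r s) (@graded_tcomm R[i] r s) /\
  is_3Lie_superalgebra (@cubic_hom R[i] r s) (@graded_tcomm R[i] r s).
Proof. by have L := @cubic_3Lie R[i] r s; split=> //; case: L. Qed.
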